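(* Let $G$ be a connected graph which is not complete and which does not contain two distinct triangles sharing an edge. Then $G$ is $(1,2)$-step competition-realizable if and only if $G$ is isomorphic to the star $K_{1,4}$.
   Context: For vertices $x,y$ of a digraph $H$, $d_H(x,y)$ denotes the number of arcs in a shortest directed path from $x$ to $y$ in $H$. The $(1,2)$-step competition graph $C_{1,2}(D)$ of a digraph $D$ is the simple graph on $V(D)$ in which distinct $u,v$ are adjacent iff there is $w\neq u,v$ with either $d_{D-v}(u,w)\le 1$ and $d_{D-u}(v,w)\le 2$, or $d_{D-u}(v,w)\le 1$ and $d_{D-v}(u,w)\le 2$. A bipartite tournament is an orientation of a complete bipartite graph $K_{m,n}$ ($m,n\ge 1$). A graph is $(1,2)$-step competition-realizable if it is isomorphic to $C_{1,2}(D)$ for some bipartite tournament $D$. *)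

(* Defs.v *)
From mathcomp Require Import all_boot.

Set Implicit Arguments.
Unset Strict Implicit.
Unset Printing Implicit Defensive.

(* Loopless simple graphs are symmetric irreflexive relations on a finType;
   digraphs are arbitrary relations on a finType. *)

Definition graph_iso (V W : finType) (g : rel V) (h : rel W) : Prop :=
  exists f : V -> W, bijective f /\ forall x y, h (f x) (f y) = g x y.

(* This allows the empty graph. *)
Definition connected_graph (V : finType) (g : rel V) : Prop :=
  forall x y, connect g x y.

Definition complete_graph (V : finType) (g : rel V) : Prop :=
  forall x y, x != y -> g x y.

Definition triangle (V : finType) (g : rel V) (S : {set V}) : Prop :=
  #|S| = 3 /\ {in S &, forall x y, x != y -> g x y}.

Definition share_edge (V : finType) (g : rel V) (S S' : {set V}) : Prop :=
  exists x y, [/\ g x y, x \in S :&: S' & y \in S :&: S'].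

Definition Kbip (m n : nat) : rel ('I_m + 'I_n) :=
  fun x y => match x, y with
             | inl _, inr _ | inr _, inl _ => true
             | _, _ => false
             end.

Definition orientation (T : finType) (D g : rel T) : Prop :=
  forall x y, (D x y || D y x = g x y) /\ ~~ (D x y && D y x).

Definition bipartite_tournament (T : finType) (D : rel T) : Prop :=
  exists (m n : nat) (g : rel T),
    [/\ 0 < m, 0 < n, graph_iso g (@Kbip m n) & orientation D g].

Definition has_dipath (T : finType) (D : rel T) (x y : T) (k : nat) : bool :=
  [exists p : k.-tuple T, [&& path D x p, last x p == y & uniq (x :: p)]].

(* The distance is [None] when no path exists; the search stops at #|T|
   because a path on k arcs has k.+1 distinct vertices. *)
Definition dist (T : finType) (D : rel T) (x y : T) : option nat :=
  let k := find (has_dipath D x y) (iota 0 #|T|) in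
  if k < #|T| then Some k else None.

Definition dist_le (d : option nat) (k : nat) : bool :=
  if d is Some i then i <= k else false.

(* D - v is kept on the same vertex type, with v isolated; this does not
   affect distances between vertices other than v. *)
Definition del_vertex (T : finType) (D : rel T) (v : T) : rel T :=
  fun x y => [&& x != v, y != v & D x y].

Definition C12 (T : finType) (D : rel T) : rel T :=
  fun u v => (u != v) &&
    [exists w, [&& w != u, w != v &
      (dist_le (dist (del_vertex D v) u w) 1
         && dist_le (dist (del_vertex D u) v w) 2)
      || (dist_le (dist (del_vertex D u) v w) 1
         && dist_le (dist (del_vertex D v) u w) 2)]].

Definition C12_realizable (V : finType) (g : rel V) : Prop :=
  exists (T : finType) (D : rel T), bipartite_tournament D /\ graph_iso g (C12 D).

Lemma dist_leP (T : finType) (D : rel T) (x y : T) (k : nat) :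
  dist_le (dist D x y) k <->
  exists p, [/\ path D x p, last x p = y, uniq (x :: p) & size p <= k].
Proof.
rewrite /dist; set f := find _ _; split.
  case: ltnP => //= ltf lefk.
  have hs : has (has_dipath D x y) (iota 0 #|T|) by rewrite has_find size_iota.
  have := nth_find 0 hs; rewrite -/f nth_iota // add0n.
  case/existsP=> p /and3P[Dp /eqP lp up]; exists p; split=> //.
  by rewrite size_tuple.
case=> p [Dp lp up lepk].
have ltp : size p < #|T| by have := max_card (mem (x :: p)); rewrite (card_uniqP up).
have lefp : f <= size p.
  rewrite leqNgt; apply/negP => /(before_find 0).
  rewrite nth_iota // add0n => /negbT/negP[]; apply/existsP.
  by exists (in_tuple p); rewrite Dp lp eqxx up.
by rewrite (leq_ltn_trans lefp ltp) /= (leq_trans lefp lepk).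
Qed.

(* Main.v *)
(** In a bipartite tournament without sinks, two vertices on the same side are
adjacent in C12 iff they have a common out-neighbour, and two vertices u, v on
opposite sides are adjacent unless N+(u) = {v} or N+(v) = {u}.  So C12 has a lot
of edges, and each in-neighbourhood is a clique.  If no two triangles share an
edge, then all indegrees are at most 2, and as soon as a vertex has indegree 2
almost every vertex of its side has outdegree 1.  This rules out that both sides
have at least three vertices.  A side with a single vertex a isolates a in C12,
so some side is a pair {a1, a2}.  If no vertex dominates both, then a2
and the in-neighbours of a1 form a union of components of C12; otherwise the
indegree bound leaves five vertices, and C12 is a star. *)

Require Import Defs.
From mathcomp Require Import all_boot.

Set Implicit Arguments.
Unset Strict Implicit.
Unset Printing Implicit Defensive.

(** * Isomorphisms, stars and connectedness of graphs *)

Lemma graph_iso_sym (V W : finType) (g : rel V) (h : rel W) :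
  graph_iso g h -> graph_iso h g.
Proof.
case=> f [[f' fK f'K] gh]; exists f'; split; first by exists f.
by move=> x y; rewrite -gh !f'K.
Qed.

Lemma graph_iso_trans (U V W : finType) (e : rel U) (g : rel V) (h : rel W) :
  graph_iso e g -> graph_iso g h -> graph_iso e h.
Proof.
case=> f [bf eg] [f' [bf' gh]]; exists (f' \o f); split; first exact: bij_comp.
by move=> x y; rewrite /= gh eg.
Qed.

Lemma star_iso (T : finType) (h : rel T) (c : T) (n : nat) :
  #|T| = n.+1 ->
  (forall x y, h x y = (x != y) && ((x == c) || (y == c))) ->
  graph_iso h (@Kbip 1 n).
Proof.
move=> cT hE; apply: graph_iso_sym.
have cC : #|predC1 c| = n by have := cardC1 c; rewrite cT.
pose leaf i : T := enum_val (cast_ord (esym cC) i).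
have leafc i : leaf i != c by have := enum_valP (cast_ord (esym cC) i).
have leafI : injective leaf by move=> i j /enum_val_inj/cast_ord_inj.
exists (fun v : 'I_1 + 'I_n => match v with inl _ => c | inr i => leaf i end).
split.
  apply: inj_card_bij; last by rewrite card_sum !card_ord cT.
  move=> [i|i] [j|j] //=; first by rewrite !ord1.
  - by move/esym/eqP; rewrite (negPf (leafc j)).
  - by move/eqP; rewrite (negPf (leafc i)).
  by move/leafI->.
move=> [i|i] [j|j]; rewrite hE /= ?eqxx ?(negPf (leafc _)) ?andbF ?andbT //.
by rewrite eq_sym leafc.
Qed.

Lemma connect_invariant (T : finType) (h : rel T) (P : pred T) :
  connected_graph h -> (forall x y, h x y -> P x -> P y) ->
  forall x y, P x -> P y.
Proof.
move=> hconn hP x y; case/connectP: (hconn x y) => p + ->.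
by elim: p x => //= z p IHp x /andP[/hP xz /IHp zp] /xz.
Qed.

(* The colouring [s] names the two sides of the tournament; exchanging the
   sides leaves [s x != s y] unchanged, so every lemma below holds for both. *)
Section BipartiteTournament.

Context (T : finType) (D : rel T) (s : T -> bool).
Hypothesis Ds : orientation D (fun x y => s x != s y).

Lemma arc_side x y : D x y -> s x != s y.
Proof. by have [<- _] := Ds x y => ->. Qed.

Lemma arc_asym x y : D x y -> D y x = false.
Proof. by move=> xy; have [_] := Ds x y; rewrite xy => /negPf. Qed.

Lemma arc_total x y : s x != s y -> ~~ D x y -> D y x.
Proof. by have [<- _] := Ds x y => /orP[->|]. Qed.

(** * Short distances and the adjacency rules of [C12] *)

Lemma dist_le2 (H : rel T) x y : dist_le (dist H x y) 2 ->
  [\/ x = y, H x y | exists2 z, H x z & H z y].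
Proof.
case/dist_leP=> [[|a [|b [|? ?]]]] /= [] // Hp <- _ _; first by constructor 1.
- by constructor 2; case/andP: Hp.
by constructor 3; case/and3P: Hp; exists a.
Qed.

Lemma dist_le1P (H : rel T) x y : x != y -> dist_le (dist H x y) 1 = H x y.
Proof.
move=> xy; apply/idP/idP=> [/dist_leP[[|a [|? ?]]] /= [] // Hp exy _ _|Hxy].
- by rewrite exy eqxx in xy.
- by case/andP: Hp; rewrite exy.
by apply/dist_leP; exists [:: y]; rewrite /= inE Hxy xy.
Qed.

Lemma dist_le2_path (H : rel T) x z y :
  H x z -> H z y -> uniq [:: x; z; y] -> dist_le (dist H x y) 2.
Proof. by move=> xz zy u; apply/dist_leP; exists [:: z; y]; rewrite /= xz zy. Qed.

(** Serves both disjuncts of [C12], with [u] and [v] exchanged for the second. The midpoint [z]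
    avoids [u] because the path lives in the digraph without [u]. *)
Lemma half_witness u v w : w != u -> w != v ->
  dist_le (dist (del_vertex D v) u w) 1 ->
  dist_le (dist (del_vertex D u) v w) 2 ->
  D u w /\ (D v w \/ exists z, [/\ z != u, D v z & D z w]).
Proof.
move=> wu wv; rewrite dist_le1P 1?eq_sym // => /and3P[_ _ uw] /dist_le2[vw|/and3P[_ _ vw]|].
- by rewrite vw eqxx in wv.
- by split; [|left].
by case=> z /and3P[_ zu vz] /and3P[_ _ zw]; split=> //; right; exists z.
Qed.

Lemma arc_neq x y : D x y -> y != x.
Proof. by move/arc_side; apply: contraNneq => ->. Qed.

(** Every arc changes side. A two-arc path from one of [u], [v] therefore ends on their own side,
    while an arc from the other ends on the opposite side, so a witness is reached by single arcs
    from both. *)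
Lemma C12_same u v : s u = s v ->
  C12 D u v <-> u != v /\ exists w, D u w /\ D v w.
Proof.
move=> suv; have half x y w : s x = s y -> D x w ->
    D y w \/ (exists z, [/\ z != x, D y z & D z w]) -> D y w.
  move=> sxy /arc_side xw [//|[z [_ /arc_side yz /arc_side zw]]].
  by move: xw yz zw; rewrite sxy; do 3!case: (s _).
rewrite /C12; split=> [/andP[uv /existsP[w /and3P[wu wv]]]|[uv [w [uw vw]]]].
  move=> dw; split=> //; exists w; case/orP: dw => /andP[].
    by move=> uw /(half_witness wu wv uw) [{}uw /(half _ _ _ suv uw)].
  by move=> vw /(half_witness wv wu vw) [{}vw /(half _ _ _ (esym suv) vw)].
rewrite uv; apply/existsP; exists w; rewrite !arc_neq //=; apply/orP; left.
have [wu wv] := (arc_neq uw, arc_neq vw).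
rewrite dist_le1P 1?eq_sym // /del_vertex /= uv wv uw /=.
by apply/dist_leP; exists [:: w]; rewrite /= inE [v == u]eq_sym [v == w]eq_sym uv wu wv vw.
Qed.

(** By parity one of the two vertices reaches the witness by exactly two arcs, and the midpoint is
    the out-neighbour required of it. Conversely, the given out-neighbours lie on opposite sides,
    hence are joined by an arc, and the head of that arc is a witness. *)
Lemma C12_cross u v : s u != s v ->
  C12 D u v <-> (exists2 w, D u w & w != v) /\ (exists2 w, D v w & w != u).
Proof.
move=> suv; have half x y w : s x != s y -> D x w ->
    D y w \/ (exists z, [/\ z != x, D y z & D z w]) -> exists2 z, D y z & z != x.
  move=> sxy /arc_side xw [/arc_side yw|[z [zx yz _]]]; last by exists z.
  by move: sxy xw yw; do 3!case: (s _).
have uv : u != v by apply: contraNneq suv => ->.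
have reach x y w z : s x != s y -> D x w -> w != y -> D y z -> z != x -> D z w ->
    dist_le (dist (del_vertex D y) x w) 1 && dist_le (dist (del_vertex D x) y w) 2.
  move=> sxy xw wy yz zx zw; have [wx zy] := (arc_neq xw, arc_neq yz).
  have xy : x != y by apply: contraNneq sxy => ->.
  rewrite dist_le1P 1?eq_sym // /del_vertex /= xy wy xw /=.
  apply: (@dist_le2_path _ _ z); rewrite /= ?inE ?[y == _]eq_sym ?xy ?zx ?wx ?yz ?zw //=.
  by rewrite negb_or zy wy eq_sym (arc_neq zw).
rewrite /C12 uv; split=> [/existsP[w /and3P[wu wv]]|[[w uw wv] [z vz zu]]].
  case/orP=> /andP[].
    move=> uw /(half_witness wu wv uw) [{}uw /(half _ _ _ suv uw)].
    by split=> //; exists w.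
  rewrite eq_sym in suv.
  move=> vw /(half_witness wv wu vw) [{}vw /(half _ _ _ suv vw)].
  by split=> //; exists w.
have szw : s z != s w.
  by move: suv (arc_side uw) (arc_side vz); do 4!case: (s _).
have [zw|/(arc_total szw) wz] := boolP (D z w); apply/existsP.
  by exists w; rewrite arc_neq // wv (reach _ _ _ z).
by exists z; rewrite zu arc_neq // (reach v _ _ w) ?orbT // eq_sym.
Qed.

Lemma C12_sym : symmetric (C12 D).
Proof.
move=> u v; rewrite /C12 eq_sym; congr andb; apply: eq_existsb => w.
by rewrite orbC !andbA [(w != u) && _]andbC.
Qed.

Lemma same_adj w u v : u != v -> D u w -> D v w -> C12 D u v.
Proof.
move=> uv uw vw; apply/C12_same; last by split=> //; exists w.
by move: (arc_side uw) (arc_side vw); do 3!case: (s _).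
Qed.

Lemma cross_adj w z u v : s u != s v ->
  D u w -> w != v -> D v z -> z != u -> C12 D u v.
Proof. by move=> suv uw wv vz zu; apply/C12_cross=> //; split; [exists w|exists z]. Qed.

Lemma adj_out u v : C12 D u v -> exists w, D u w.
Proof.
have [suv|suv] := eqVneq (s u) (s v).
  by case/C12_same=> // _ [w [uw _]]; exists w.
by case/C12_cross=> // [[w uw _] _]; exists w.
Qed.

Lemma same_side_neq b x y : D x b -> D b y -> x != y.
Proof. by move=> xb; apply: contraTneq => <-; rewrite arc_asym. Qed.

(** * The tournament that yields the star *)

(** The tournament is the directed 4-cycle [a1], [b1], [a2], [b2] with a source [c], which becomes
    the centre. Each cycle vertex has its successor as only out-neighbour, and distinct successors
    leave no adjacency among the four. *)
Lemma C12_star a1 a2 b1 b2 c :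
  (forall x, x \in [:: a1; a2; b1; b2; c]) ->
  D a1 b1 -> D a2 b2 -> D b1 a2 -> D b2 a1 -> D c a1 -> D c a2 ->
  graph_iso (C12 D) (@Kbip 1 4).
Proof.
move=> T5 a1b1 a2b2 b1a2 b2a1 ca1 ca2.
have sides : [/\ s a2 = s a1, s b1 = ~~ s a1, s b2 = ~~ s a1 & s c = ~~ s a1].
  move: (arc_side a1b1) (arc_side a2b2) (arc_side b1a2) (arc_side b2a1) (arc_side ca1).
  by do 5!case: (s _).
case: sides => sa2 sb1 sb2 sc.
have a12 := same_side_neq a1b1 b1a2.
have b1c : b1 != c by rewrite eq_sym (same_side_neq ca1).
have b2c : b2 != c by rewrite eq_sym (same_side_neq ca2).
have b12 := same_side_neq b1a2 a2b2.
have diff x y : s x != s y -> x != y by apply: contraNneq => ->.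
have uT : uniq [:: a1; a2; b1; b2; c].
  by rewrite /= !inE !negb_or a12 b12 b1c b2c !diff ?sa2 ?sb1 ?sb2 ?sc //; case: (s a1).
apply: (@star_iso _ _ c).
  by apply: etrans (card_uniqP uT); apply: eq_card => x; rewrite T5.
have cN x : x != c -> C12 D c x.
  move=> xc; have := T5 x; rewrite !inE (negPf xc) orbF.
  case/or4P=> /eqP->.
  - apply: (cross_adj (w := a2) (z := b1)) => //; rewrite 1?eq_sym // ?sc; by case: (s a1).
  - apply: (cross_adj (w := a1) (z := b2)) => //; rewrite 1?eq_sym // ?sc ?sa2; by case: (s a1).
  - by apply: (same_adj (w := a2)); rewrite 1?eq_sym.
  - by apply: (same_adj (w := a1)); rewrite 1?eq_sym.
have same_side x y : s x = s y -> D x y = false.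
  by move=> sxy; apply/negP=> /arc_side; rewrite sxy eqxx.
have out_only x w : (forall y, y \in [:: a1; a2; b1; b2; c] -> y != w -> D x y = false) ->
    forall y, D x y -> y = w.
  by move=> H y xy; apply/eqP; apply: contraTT xy => yw; rewrite H.
have rev := (arc_asym a1b1, arc_asym a2b2, arc_asym b1a2, arc_asym b2a1,
             arc_asym ca1, arc_asym ca2).
have oa1 : forall w, D a1 w -> w = b1.
  apply: out_only => y; rewrite !inE => /or4P[|||/orP[]] /eqP->;
    by rewrite ?rev ?eqxx // ?same_side ?sa2.
have oa2 : forall w, D a2 w -> w = b2.
  apply: out_only => y; rewrite !inE => /or4P[|||/orP[]] /eqP->;
    by rewrite ?rev ?eqxx // ?same_side ?sa2.
have ob1 : forall w, D b1 w -> w = a2.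
  apply: out_only => y; rewrite !inE => /or4P[|||/orP[]] /eqP->;
    by rewrite ?rev ?eqxx // ?same_side ?sb1 ?sb2 ?sc.
have ob2 : forall w, D b2 w -> w = a1.
  apply: out_only => y; rewrite !inE => /or4P[|||/orP[]] /eqP->;
    by rewrite ?rev ?eqxx // ?same_side ?sb1 ?sb2 ?sc.
have cross_nadj x y : s x != s y -> (forall w, D x w -> w = y) -> C12 D x y = false.
  by move=> sxy xo; apply/negP=> /C12_cross[] // [w /xo -> /eqP].
have same_nadj x y x' y' : x' != y' -> s x = s y ->
   (forall w, D x w -> w = x') -> (forall w, D y w -> w = y') -> C12 D x y = false.
  move=> xy' sxy xo yo; apply/negP=> /C12_same[] // _ [w [/xo -> /yo exy]].
  by rewrite exy eqxx in xy'.
have C_irr x : C12 D x x = false by rewrite /C12 eqxx.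
have a1a2 : C12 D a1 a2 = false by apply: (same_nadj _ _ b1 b2).
have b1b2 : C12 D b1 b2 = false.
  by apply: (same_nadj _ _ a2 a1); rewrite 1?eq_sym // sb1.
have [a1b1' a2b2'] : C12 D a1 b1 = false /\ C12 D a2 b2 = false.
  by split; apply: cross_nadj; rewrite ?sa2 ?sb1 ?sb2 //; case: (s a1).
have [b1a2' b2a1'] : C12 D b1 a2 = false /\ C12 D b2 a1 = false.
  by split; apply: cross_nadj; rewrite ?sa2 ?sb1 ?sb2 //; case: (s a1).
have nadj := (C_irr, a1a2, b1b2, a1b1', a2b2', b1a2', b2a1').
have leaves x y : x != c -> y != c -> C12 D x y = false.
  move=> xc yc; have := T5 x; have := T5 y; rewrite !inE (negPf xc) (negPf yc) !orbF.
  by case/or4P=> /eqP-> /or4P[] /eqP->; rewrite ?nadj // C12_sym nadj.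
move=> x y; have [->|xc] := eqVneq x c.
  have [->|yc] := eqVneq y c; first by rewrite C_irr.
  by rewrite cN // eq_sym yc.
have [->|yc] := eqVneq y c; first by rewrite C12_sym cN // xc.
by rewrite leaves // andbF.
Qed.

(** * Bounds on the sides in the absence of diamonds *)

Section DiamondFree.

Hypothesis no_diamond : forall x y z t,
  C12 D x y -> C12 D x z -> C12 D y z -> C12 D x t -> C12 D y t -> z = t.
Hypothesis out : forall x, exists y, D x y.

(** Two of the in-neighbours of [b] differ from a chosen out-neighbour [x] of [b']. Both are
    adjacent to [b'] and to the third in-neighbour, as well as to each other, which is a diamond. *)
Lemma indegree_le2 b b' a1 a2 a3 : s b = s b' -> b != b' ->
  a1 != a2 -> a1 != a3 -> a2 != a3 -> D a1 b -> D a2 b -> D a3 b -> False.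
Proof.
move=> sb bb' a12 a13 a23 a1b a2b a3b.
have [x b'x] := out b'.
have base u v t : x != u -> x != v -> u != v -> u != t -> v != t ->
    D u b -> D v b -> D t b -> False.
  move=> xu xv uv ut vt ub vb tb.
  suff e : b' = t by move: (arc_side tb); rewrite sb e eqxx.
  apply: (no_diamond (x := u) (y := v)).
  - exact: same_adj ub vb.
  - by apply: (cross_adj _ ub bb' b'x xu); rewrite -sb arc_side.
  - by apply: (cross_adj _ vb bb' b'x xv); rewrite -sb arc_side.
  - exact: same_adj ub tb.
  - exact: same_adj vb tb.
have [x1|x1] := eqVneq x a1.
  by subst x; apply: (base a2 a3 a1) => //; rewrite eq_sym.
have [x2|x2] := eqVneq x a2.
  by subst x; apply: (base a1 a3 a2) => //; rewrite eq_sym.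
exact: (base a1 a2 a3).
Qed.

(** Otherwise [b1] and [b2] each have an out-neighbour other than [a1] and one other than [a2]. Both
    are then adjacent to the adjacent vertices [a1] and [a2]. *)
Lemma out_single b b1 b2 a1 a2 : s b = s b1 -> s b = s b2 ->
  b != b1 -> b != b2 -> b1 != b2 -> a1 != a2 -> D a1 b -> D a2 b ->
  exists b' a, [/\ b' = b1 \/ b' = b2, a = a1 \/ a = a2 &
    forall x, D b' x -> x = a].
Proof.
move=> sb1 sb2 bb1 bb2 b12 a12 a1b a2b.
have single b' a : (forall x, D b' x -> x = a) \/ exists2 x, D b' x & x != a.
  have [/forallP H|/forallPn[x]] := boolP [forall x, D b' x ==> (x == a)].
    by left=> x b'x; have := H x; rewrite b'x => /eqP.
  by rewrite negb_imply => /andP[b'x xa]; right; exists x.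
have [H|H11] := single b1 a1; first by exists b1, a1; split; [left|left|].
have [H|H12] := single b1 a2; first by exists b1, a2; split; [left|right|].
have [H|H21] := single b2 a1; first by exists b2, a1; split; [right|left|].
have [H|H22] := single b2 a2; first by exists b2, a2; split; [right|right|].
have adj a b' : D a b -> s b = s b' -> b != b' -> (exists2 x, D b' x & x != a) -> C12 D a b'.
  move=> ab sb bb' [x b'x xa]; apply: (cross_adj _ ab bb' b'x xa).
  by rewrite -sb arc_side.
case/eqP: b12; apply: (no_diamond (x := a1) (y := a2)); try exact: adj.
exact: same_adj a1b a2b.
Qed.

(** Since [b'] sends an arc to [a1] only, it receives arcs from [a2] and [a3]. This makes [a2]
    adjacent to [a1], [a3], [b] and [b'], and the arcs at [b''] then decide where a diamond through
    [a2] appears. *)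
Lemma no_3x3_aux a1 a2 a3 b b' b'' :
  uniq [:: a1; a2; a3] -> uniq [:: b; b'; b''] ->
  s a1 = s a2 -> s a1 = s a3 -> s b = s b' -> s b = s b'' ->
  D a1 b -> D a2 b -> (forall x, D b' x -> x = a1) -> False.
Proof.
rewrite /= !inE !negb_or !andbT => /andP[/andP[a12 a13] a23] /andP[/andP[bb1 bb2] b12].
move=> sa2 sa3 sb1 sb2 a1b a2b b'out.
have [a21 a31 a32] : [/\ a2 != a1, a3 != a1 & a3 != a2] by split; rewrite eq_sym.
have [b1b b2b b21] : [/\ b' != b, b'' != b & b'' != b'].
  by split; rewrite eq_sym.
have cross x y : s x = s a1 -> s y = s b -> s x != s y.
  by move=> -> ->; apply: arc_side.
have cross' x y : s x = s a1 -> s y = s b -> s y != s x.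
  by move=> *; rewrite eq_sym cross.
have b'a1 : D b' a1 by have [x b'x] := out b'; rewrite -(b'out _ b'x).
have to_b' x : s x = s a1 -> x != a1 -> D x b'.
  move=> sx xa1; apply: arc_total; first by rewrite cross'.
  by apply: contra xa1 => /b'out->.
have a2b' : D a2 b' by apply: to_b'.
have a3b' : D a3 b' by apply: to_b'.
have side_a x : s x = s a1 -> x = a1 \/ x = a2 \/ x = a3.
  move=> sx; have [|x1] := eqVneq x a1; first by left.
  have [|x2] := eqVneq x a2; first by right; left.
  have [|x3] := eqVneq x a3; first by right; right.
  case: (@indegree_le2 b' b x a2 a3); rewrite ?to_b' //.
(* The in-neighbours [a1] and [a2] already exhaust the indegree of [b]. *)
have ba3 : D b a3.
  apply: arc_total; first by rewrite cross.
  by apply/negP=> a3b; case: (@indegree_le2 b b' a1 a2 a3).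
have a1a2 : C12 D a1 a2 by apply: same_adj a1b a2b.
have a2a3 : C12 D a2 a3 by apply: same_adj a2b' a3b'.
have Ca2b : C12 D a2 b by apply: (cross_adj _ a2b' b1b ba3); rewrite ?cross.
have Ca2b' : C12 D a2 b' by apply: (cross_adj _ a2b bb1 b'a1); rewrite ?cross.
(* In the four cases the shared edge is, in order, [a2 b''], [a2 b'], [a2 b] and [a1 a2]. *)
have [b''a1|a1b''] := boolP (D b'' a1).
  have b''b' : C12 D b'' b' by apply: same_adj b''a1 b'a1.
  have a2b'' : C12 D a2 b'' by apply: (cross_adj _ a2b bb2 b''a1); rewrite ?cross.
  have [b''a3|a3b''] := boolP (D b'' a3).
    have b''b : C12 D b'' b by apply: same_adj b''a3 ba3.
    by case/eqP: bb1; apply: (no_diamond (x := a2) (y := b'')).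
  have {}a3b'' : D a3 b'' by apply: arc_total; rewrite ?cross'.
  have a3b'C : C12 D a3 b' by apply: (cross_adj _ a3b'' b21 b'a1); rewrite ?cross.
  have e : b'' = a3 by apply: (no_diamond (x := a2) (y := b')); rewrite // C12_sym.
  by have := arc_side a3b''; rewrite e eqxx.
have {}a1b'' : D a1 b'' by apply: arc_total; rewrite ?cross'.
have Ca1b : C12 D a1 b by apply: (cross_adj _ a1b'' b2b ba3); rewrite ?cross.
have [b''a3|a3b''] := boolP (D b'' a3).
  have b''b : C12 D b'' b by apply: same_adj b''a3 ba3.
  have a2b'' : C12 D a2 b'' by apply: (cross_adj _ a2b bb2 b''a3); rewrite ?cross.
  have e : b'' = a1 by apply: (no_diamond (x := a2) (y := b)); rewrite // C12_sym.
  by have := arc_side a1b''; rewrite e eqxx.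
have {}a3b'' : D a3 b'' by apply: arc_total; rewrite ?cross'.
have a1a3 : C12 D a1 a3 by apply: same_adj a1b'' a3b''.
have e : b = a3 by apply: (no_diamond (x := a1) (y := a2)).
by have := cross a3 b (esym sa3) erefl; rewrite e eqxx.
Qed.

(** The four outcomes of [out_single] differ from the situation of [no_3x3_aux] only by exchanging
    [a1] with [a2] or [b1] with [b2]. *)
Lemma no_3x3_indegree2 a1 a2 a3 b b1 b2 :
  uniq [:: a1; a2; a3] -> uniq [:: b; b1; b2] ->
  s a1 = s a2 -> s a1 = s a3 -> s b = s b1 -> s b = s b2 ->
  D a1 b -> D a2 b -> False.
Proof.
move=> ua ub sa2 sa3 sb1 sb2 a1b a2b.
have ua' : uniq [:: a2; a1; a3].
  by rewrite (@perm_uniq _ _ [:: a1; a2; a3]) //; exact/permPl/(perm_catCA [:: a2] [:: a1]).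
have ub' : uniq [:: b; b2; b1].
  by rewrite (@perm_uniq _ _ [:: b; b1; b2]) // perm_cons; exact/permPl/(perm_catC [:: b2]).
have [bb1 bb2 b12 a12] : [/\ b != b1, b != b2, b1 != b2 & a1 != a2].
  move: ua ub; rewrite /= !inE !negb_or !andbT.
  by move=> /andP[/andP[? _] _] /andP[/andP[? ?] ?].
have [b' [a [[->|->] [->|->] b'out]]] := out_single sb1 sb2 bb1 bb2 b12 a12 a1b a2b.
- exact: (no_3x3_aux ua ub).
- by apply: (no_3x3_aux ua' ub); rewrite // -sa2.
- exact: (no_3x3_aux ua ub').
- by apply: (no_3x3_aux ua' ub'); rewrite // -sa2.
Qed.

(* If neither [b1] nor [b2] is the head of two arcs from the [a]s, each of them
   sends arcs to two of the three [a]s, so both send an arc to a common one. *)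
Lemma no_3x3 a1 a2 a3 b1 b2 b3 :
  uniq [:: a1; a2; a3] -> uniq [:: b1; b2; b3] ->
  s a1 = s a2 -> s a1 = s a3 -> s b1 = s b2 -> s b1 = s b3 -> s a1 != s b1 ->
  False.
Proof.
move=> ua ub sa2 sa3 sb2 sb3 sab.
have rot_uniq (x y z : T) : uniq [:: x; y; z] -> uniq [:: y; z; x].
  by move=> u; rewrite -(rot_uniq 1) in u.
(* Cyclic shifts of the triple bring any pair of tails to the front. *)
have in2 x y z u v w : uniq [:: x; y; z] -> uniq [:: u; v; w] ->
    s x = s y -> s x = s z -> s u = s v -> s u = s w ->
    [|| D x u && D y u, D y u && D z u | D z u && D x u] -> False.
  move=> uxyz uuvw sy sz sv sw /or3P[] /andP[].
  - exact: (no_3x3_indegree2 uxyz uuvw).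
  - by apply: (no_3x3_indegree2 (rot_uniq _ _ _ uxyz) uuvw); rewrite // -sy.
  - by apply: (no_3x3_indegree2 (rot_uniq _ _ _ (rot_uniq _ _ _ uxyz)) uuvw); rewrite // -sz.
have arcN x y : s x = s a1 -> s y = s b1 -> D y x = ~~ D x y.
  move=> sx sy; have sxy : s x != s y by rewrite sx sy.
  by have [xy|/(arc_total sxy)] := boolP (D x y); first exact: arc_asym.
have ub' := rot_uniq _ _ _ ub.
have ua' := rot_uniq _ _ _ ua; have ua'' := rot_uniq _ _ _ ua'.
have /negP B1 : ~ _ := in2 _ _ _ _ _ _ ua ub sa2 sa3 sb2 sb3.
have /negP B2 : ~ _ := in2 _ _ _ _ _ _ ua ub' sa2 sa3 (etrans (esym sb2) sb3) (esym sb2).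
have /negP A1 : ~ _ := in2 _ _ _ _ _ _ ub ua sb2 sb3 sa2 sa3.
have /negP A2 : ~ _ := in2 _ _ _ _ _ _ ub ua' sb2 sb3 (etrans (esym sa2) sa3) (esym sa2).
have /negP A3 : ~ _ := in2 _ _ _ _ _ _ ub ua'' sb2 sb3 (esym sa3) (etrans (esym sa3) sa2).
move: B1 B2 A1 A2 A3; rewrite !(arcN a1, arcN a2, arcN a3) //.
by case: (D a1 b1); case: (D a2 b1); case: (D a3 b1);
   case: (D a1 b2); case: (D a2 b2); case: (D a3 b2).
Qed.

(** * Connectedness and the case of a side with two vertices *)

Hypothesis Cconn : forall P : pred T, (forall x y, C12 D x y -> P x -> P y) ->
  forall x y, P x -> P y.

(** If [a] were alone on its side, every vertex across would have [a] as only possible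
    out-neighbour, so [a] would be isolated in [C12]. *)
Lemma exists_same_side a b : s a != s b -> exists2 a', a' != a & s a' = s a.
Proof.
move=> sab; have [/existsP[a' /andP[? /eqP ?]]|/existsPn none] :=
  boolP [exists a', (a' != a) && (s a' == s a)]; first by exists a'.
suff: b = a by move=> e; rewrite e eqxx in sab.
apply/eqP; apply: (Cconn (P := pred1 a) _ (x := a)) => [x y Cxy /eqP xa|]; last exact: eqxx.
have {}none x' : s x' = s a -> x' = a.
  by move=> sx; apply/eqP; have := none x'; rewrite sx eqxx andbT negbK.
subst x; have [say|say] := eqVneq (s y) (s a); first by rewrite /= (none y).
have := say; rewrite eq_sym => /C12_cross[/(_ Cxy)[_ [w yw wa]] _].
case/eqP: wa; apply: none.
by move: say (arc_side yw); do 3!case: (s _).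
Qed.

(** Every vertex across must send an arc to [a1] or [a2], so out-neighbours [b1] and [b2] of these
    two close up a directed 4-cycle. It remains to ask whether some [c] dominates both. *)
Lemma two_vertex_side a1 a2 b : a1 != a2 -> s a1 != s b ->
  (forall x, s x = s a1 -> x = a1 \/ x = a2) -> s a2 = s a1 ->
  graph_iso (C12 D) (@Kbip 1 4).
Proof.
move=> a12 sab side_a sa2.
have [b1 a1b1] := out a1; have [b2 a2b2] := out a2.
have out_a x w : s x != s a1 -> D x w -> w = a1 \/ w = a2.
  by move=> sx /arc_side xw; apply: side_a; move: sx xw; do 3!case: (s _).
have out_b x : s x != s a1 -> D x a1 \/ D x a2.
  by move=> sx; have [w xw] := out x; case: (out_a x w sx xw) => <-; [left|right].
have b1a2 : D b1 a2.
  have [||//] := out_b b1; first by rewrite eq_sym arc_side.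
  by rewrite arc_asym.
have b2a1 : D b2 a1.
  have [|//|] := out_b b2; first by rewrite -sa2 eq_sym arc_side.
  by rewrite arc_asym.
have [/existsP[c /andP[ca1 ca2]]|/existsPn none] := boolP [exists c, D c a1 && D c a2].
  apply: (C12_star _ a1b1 a2b2 b1a2 b2a1 ca1 ca2) => x; apply/negPn/negP.
  (* A sixth vertex [x] would be a third in-neighbour of [a1] besides [b2] and [c], or of [a2]
     besides [b1] and [c]. *)
  rewrite !inE !negb_or => /and5P[x1 x2 xb1 xb2 xc].
  have [|xa1|xa2] := out_b x.
  - by apply/negP=> /eqP/side_a[] /eqP; apply/negP.
  - apply: (@indegree_le2 a1 a2 b2 c x); rewrite // 1?eq_sym //.
    exact: same_side_neq ca2 a2b2.
  - apply: (@indegree_le2 a2 a1 b1 c x); rewrite // 1?eq_sym //.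
    exact: same_side_neq ca1 a1b1.
(* The closed set contains [b2], so connectedness would put [a1] in it. *)
suff: pred1 a2 a1 || D a1 a1 by rewrite /= (negPf a12) => /arc_side; rewrite eqxx.
have closed x y : C12 D x y -> (x == a2) || D x a1 -> (y == a2) || D y a1.
  move=> Cxy /orP[/eqP xa2|xa1].
    subst x; have [/side_a[ya1|->]|sy] := eqVneq (s y) (s a1); last 2 first.
    - by rewrite eqxx.
    - have : s a2 != s y by rewrite sa2 eq_sym.
      move/C12_cross=> [/(_ Cxy)[_ [w yw wa2]] _].
      have [e|e] := out_a y w sy yw; first by rewrite -e yw orbT.
      by rewrite e eqxx in wa2.
    subst y; have [/(_ Cxy)[_ [w [a2w a1w]]] _] := C12_same sa2.
    have [|wa1|wa2] := out_b w; first by rewrite eq_sym arc_side.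
      by rewrite arc_asym in wa1.
    by rewrite arc_asym in wa2.
  (* Here [a1] is the only out-neighbour of [x], so neighbours of [x] on its own side also send an
     arc to [a1], and [a1] itself is not adjacent to [x]. *)
  have xa2 : D x a2 = false by have := none x; rewrite xa1 => /negPf.
  have sx : s x != s a1 by apply: arc_side.
  have [sxy|sxy] := eqVneq (s x) (s y).
    have [/(_ Cxy)[_ [w [xw yw]]] _] := C12_same sxy.
    have [e|e] := out_a x w sx xw; first by rewrite -e yw orbT.
    by rewrite -e xw in xa2.
  have /side_a[ya1|->] : s y = s a1 by move: sx sxy; do 3!case: (s _).
    subst y; have [/(_ Cxy)[[w xw wa1] _] _] := C12_cross sxy.
    have [e|e] := out_a x w sx xw; first by rewrite e eqxx in wa1.
    by rewrite -e xw in xa2.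
  by rewrite eqxx.
by apply: (Cconn closed (x := b2)); rewrite b2a1 orbT.
Qed.

Lemma connected_diamond_free_star a b : s a != s b ->
  graph_iso (C12 D) (@Kbip 1 4).
Proof.
move=> sab; have [a' a'a sa'] := exists_same_side sab.
have sba : s b != s a by rewrite eq_sym.
have [b' b'b sb'] := exists_same_side sba.
have third u v : s v = s u -> v != u ->
    (forall x, s x = s u -> x = u \/ x = v) \/
    exists w, uniq [:: u; v; w] /\ s u = s w.
  move=> svu vu; have [/existsP[w]|/existsPn none] :=
    boolP [exists w, [&& w != u, w != v & s w == s u]].
    case/and3P=> wu wv /eqP; right; exists w; split=> //.
    by rewrite /= !inE !negb_or ![_ == w]eq_sym eq_sym vu wu wv.
  left=> x sx; have := none x; rewrite sx eqxx andbT negb_and !negbK.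
  by case/orP=> /eqP; [left|right].
have [side_a|[a3 [ua sa3]]] := third a a' sa' a'a.
  by apply: (two_vertex_side (a1 := a) (a2 := a') (b := b)) => //; rewrite eq_sym.
have [side_b|[b3 [ub sb3]]] := third b b' sb' b'b.
  by apply: (two_vertex_side (a1 := b) (a2 := b') (b := a)) => //; rewrite eq_sym.
by case: (no_3x3 ua ub).
Qed.

End DiamondFree.

End BipartiteTournament.

(** * Transfer to abstract graphs and the equivalence *)

Lemma bipartite_tournament_side (T : finType) (D : rel T) :
  bipartite_tournament D ->
  exists s : T -> bool, orientation D (fun x y => s x != s y) /\
    exists a b, s a != s b.
Proof.
case=> m [n [g [m0 n0 [f [[f' fK f'K] fg]] gD]]].
exists (fun x => if f x is inl _ then true else false); split.
  move=> x y; have [-> ->] := gD x y; split=> //.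
  by rewrite -fg; case: (f x); case: (f y).
by exists (f' (inl (Ordinal m0))), (f' (inr (Ordinal n0))); rewrite !f'K.
Qed.

(* The 4-cycle 0, 0', 1, 1' together with a source 2' on the side of size 3. *)
Definition cycle4_source : rel ('I_2 + 'I_3) := fun x y =>
  match x, y with
  | inl i, inr j => i == j :> nat
  | inr j, inl i => i != j :> nat
  | _, _ => false
  end.

Lemma star4_realizable : C12_realizable (@Kbip 1 4).
Proof.
exists ('I_2 + 'I_3)%type, cycle4_source; split.
  exists 2, 3, (@Kbip 2 3); split=> //; first by exists id; split=> //; exists id.
  by move=> [i|j] [k|l] //=; case: eqP.
apply: graph_iso_sym.
apply: (@C12_star _ _ (fun x => if x is inl _ then true else false) _
  (inl ord0) (inl ord_max) (inr ord0) (inr (@Ordinal 3 1 isT)) (inr ord_max)) => //=.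
  by move=> [i|j] [k|l] //=; case: eqP.
by case=> [[[|[|i]] lti]|[[|[|[|j]]] ltj]].
Qed.

Lemma triangle_set3 (V : finType) (g : rel V) (x y z : V) :
  symmetric g -> irreflexive g -> g x y -> g x z -> g y z ->
  triangle g [set x; y; z].
Proof.
move=> g_sym g_irr xy xz yz.
have neq u v : g u v -> u != v by apply: contraTneq => ->; rewrite g_irr.
split; first by rewrite -setUA !cardsU1 cards1 !inE negb_or !neq.
move=> u v; rewrite !inE => /orP[/orP[]|] /eqP-> /orP[/orP[]|] /eqP-> //;
  by rewrite ?eqxx // g_sym.
Qed.

Theorem theorem3p7 (V : finType) (g : rel V)
  (g_sym : symmetric g) (g_irr : irreflexive g)
  (g_conn : connected_graph g)
  (g_ncomplete : ~ complete_graph g)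
  (g_tri : ~ exists S S' : {set V},
     [/\ triangle g S, triangle g S', S <> S' & share_edge g S S']) :
  C12_realizable g <-> graph_iso g (@Kbip 1 4).
Proof.
split=> [[T [D [bD gC]]]|gK]; last first.
  have [T [D [bD KC]]] := star4_realizable.
  by exists T, D; split=> //; apply: graph_iso_trans KC.
have [s [Ds [a [b sab]]]] := bipartite_tournament_side bD.
apply: graph_iso_trans (gC) _; have [f [[f' fK f'K] fg]] := gC.
have gf' x y : g (f' x) (f' y) = C12 D x y by rewrite -fg !f'K.
have conn (P : pred T) : (forall x y, C12 D x y -> P x -> P y) ->
    forall x y, P x -> P y.
  move=> HP x y; rewrite -(f'K x) -(f'K y).
  by apply: (connect_invariant (P := P \o f) g_conn) => u v; rewrite -fg => /HP.
(* Distinct [z] and [t] would give two distinct triangles of [g] on the edge between [f' x] and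
   [f' y]. *)
have no_diamond x y z t : C12 D x y -> C12 D x z -> C12 D y z ->
    C12 D x t -> C12 D y t -> z = t.
  rewrite -!gf' => xy xz yz xt yt; apply/eqP/negPn/negP => zt; case: g_tri.
  exists [set f' x; f' y; f' z], [set f' x; f' y; f' t].
  split; [exact: triangle_set3|exact: triangle_set3| |].
    move=> /setP/(_ (f' z)); rewrite !inE eqxx orbT [f' z == f' t](inj_eq (can_inj f'K)) (negPf zt) orbF.
    by case/esym/orP=> /eqP e; rewrite e g_irr in xz yz.
  by exists (f' x), (f' y); rewrite !inE !eqxx ?orbT.
(* A sink is isolated in [C12], so connectedness would leave a single vertex, although both sides
   are inhabited. *)
have out x : exists y, D x y.
  have [/existsP//|/existsPn sink] := boolP [exists y, D x y].
  have isolated y : x = y.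
    apply/esym/eqP; apply: (conn (pred1 x) _ x) => [u v Cuv /eqP ux|]; last exact: eqxx.
    have [w] := adj_out Ds Cuv.
    by rewrite ux (negPf (sink w)).
  by rewrite -(isolated a) -(isolated b) eqxx in sab.
exact: (connected_diamond_free_star Ds no_diamond out conn sab).
Qed.
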